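(* Let $\{P_n\}_{n\ge 0}$ be a Laguerre–Hahn monic orthogonal polynomial sequence, with $\Phi,B_0,C_n,D_n,\gamma_{n+1}$ and $P_n^{(1)}$ as in the context. Then for every $n\ge 0$ and each $k\in\{1,2,3,4\}$, $$G_{0,k}(x;n)P^{(1)}_{n-1}(x)+G_{1,k}(x;n)P^{(1)}_{n}(x)+H_{k}(x;n)P_{n}(x)=F_{k}(x;n),$$ where (omitting the argument $x$ in $\Phi,B_0,C_j,D_j$ and the arguments $(x;n)$ in $G,H,M,F$; primes denote $d/dx$): $k=1$: $G_{0,1}=0$, $G_{1,1}=B_0$, $H_1=-\gamma_{n+1}D_{n+1}$, $F_1=\Phi P_{n+1}'+M_{0,1}P_{n+1}$; $k=2$: $G_{0,2}=-2\gamma_{n+1}B_0D_{n+1}$, $G_{1,2}=\tfrac12(C_{n+1}+C_0)B_0+\Phi B_0'$, $H_2=\gamma_{n+1}\{\tfrac12(C_{n+1}+C_0)D_{n+1}-\Phi D_{n+1}'\}$, $F_2=\Phi^2P_{n+1}''+M_{1,2}P_{n+1}'+M_{0,2}P_{n+1}$; $k=3$: $G_{0,3}=\gamma_{n+1}\{D_{n+1}(C_{n+1}-C_0)B_0-3\Phi(B_0D_{n+1})'\}$, $$G_{1,3}=B_0\{\tfrac14(C_{n+1}+C_0)^2-2\gamma_{n+1}D_nD_{n+1}+\tfrac12\Phi(C_{n+1}+C_0)'\}+\Phi B_0'\{C_{n+1}+C_0+\Phi'\}+\Phi^2B_0'',$$ $$H_3=\gamma_{n+1}\{2B_0D_0+\tfrac12(C_{n+1}+C_0)'\Phi-\tfrac14(C_{n+1}+C_0)^2\}D_{n+1}+\gamma_{n+1}\Phi(C_{n+1}+C_0-\Phi')D_{n+1}'-\gamma_{n+1}\Phi^2D_{n+1}'',$$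 $F_3=\Phi^3P_{n+1}^{(3)}+M_{2,3}P_{n+1}''+M_{1,3}P_{n+1}'+M_{0,3}P_{n+1}$; $k=4$: $G_{0,4}=-\tfrac12(C_{n+1}-C_0)G_{0,3}-\gamma_{n+1}D_{n+1}G_{1,3}+B_0H_3+\Phi G_{0,3}'$, $G_{1,4}=D_nG_{0,3}+\tfrac12(C_{n+1}+C_0)G_{1,3}+\Phi G_{1,3}'$, $H_4=-D_0G_{0,3}-\tfrac12(C_{n+1}+C_0)H_3+\Phi H_3'$, $F_4=\Phi^4P_{n+1}^{(4)}+M_{3,4}P_{n+1}^{(3)}+M_{2,4}P_{n+1}''+M_{1,4}P_{n+1}'+M_{0,4}P_{n+1}$; and where $M_{0,1}=-\tfrac12(C_{n+1}-C_0)$, $M_{1,2}=\Phi(\Phi'+M_{0,1})$, $M_{0,2}=\Phi M_{0,1}'+B_0D_0+\gamma_{n+1}D_nD_{n+1}$, $M_{2,3}=\Phi(M_{1,2}+2\Phi\Phi')$, $M_{1,3}=\Phi(M_{0,2}+M_{1,2}')$, $M_{0,3}=\Phi M_{0,2}'+D_0G_{1,2}-D_nH_2$, $M_{3,4}=\Phi\{M_{2,3}+3\Phi^2\Phi'\}$, $M_{2,4}=\Phi\{M_{2,3}'+M_{1,3}\}$, $M_{1,4}=\Phi\{M_{1,3}'+M_{0,3}\}$, $M_{0,4}=\Phi M_{0,3}'+D_0G_{1,3}-D_nH_3$.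
   Context: A form $u$ is a linear functional on the space of complex polynomials, with moments $(u)_n=\langle u,x^n\rangle$. It is regular, with monic orthogonal polynomial sequence (MOPS) $\{P_n\}_{n\ge0}$, if $P_n$ is monic of degree $n$ and $\langle u,P_nP_m\rangle=r_n\delta_{n,m}$ with all $r_n\neq0$. Forms are normalized: $(u)_0=1$. A MOPS satisfies $P_0=1$, $P_1=x-\beta_0$, $P_{n+2}=(x-\beta_{n+1})P_{n+1}-\gamma_{n+1}P_n$ ($n\ge0$), with $\beta_n\in\mathbb C$, $\gamma_{n+1}\in\mathbb C\setminus\{0\}$. The associated polynomials of order one are $P_n^{(1)}(x)=\big\langle u_\xi,\frac{P_{n+1}(x)-P_{n+1}(\xi)}{x-\xi}\big\rangle$, $n\ge0$ ($u$ acting on the variable $\xi$), and $P_{-1}^{(1)}=0$. They should not be confused with derivatives; $P_{n+1}^{(3)},P_{n+1}^{(4)}$ denote third and fourth derivatives. The formal Stieltjes function of $u$ is $S(u)(z)=-\sum_{n\ge0}(u)_n z^{-n-1}$. The regular form $u$ (and its MOPS) is Laguerre–Hahn if there are polynomials $\Phi,B,C,D$, with $\Phi$ monic (in particular nonzero), such that, as formal series in $1/z$, $\Phi(z)S'(u)(z)=B(z)S(u)(z)^2+C(z)S(u)(z)+D(z)$. Fix such polynomials. Define polynomials $C_n,D_n$ by $B_0=B$, $C_0=C$, $D_0=D$, $D_{-1}=B$, $\gamma_0=1$, and for $n\ge0$: $C_{n+1}(x)=-C_n(x)+2(x-\beta_n)D_n(x)$, $\gamma_{n+1}D_{n+1}(x)=-\Phi(x)+\gamma_nD_{n-1}(x)-(x-\beta_n)C_n(x)+(x-\beta_n)^2D_n(x)$.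 *)

(* Defs.v *)
From HB Require Import structures.
From mathcomp Require Import all_boot all_order all_algebra.
From mathcomp Require Import boolp classical_sets fsbigop.

Set Implicit Arguments.
Unset Strict Implicit.
Unset Printing Implicit Defensive.

Import GRing.Theory.

Local Open Scope ring_scope.

(** * Forms and orthogonal polynomial sequences *)

Section Forms.
Variable K : fieldType.
Implicit Types (u : {scalar {poly K}}) (P : nat -> {poly K}).

Definition moment u (n : nat) : K := u 'X^n.

Definition normalized u : Prop := moment u 0 = 1.

(* [u] is regular exactly when such a [P] exists. *)
Definition is_mops u P : Prop :=
  (forall n, P n \is monic /\ size (P n) = n.+1) /\
  exists r : nat -> K,
    (forall n, r n != 0) /\
    forall n m, u (P n * P m) = if n == m then r n else 0.

(* [gamma 0 = 1] is the convention used in the recursion for [D_n]. *)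
Definition recurrence_coeffs P (beta gamma : nat -> K) : Prop :=
  [/\ P 0%N = 1, P 1%N = 'X - (beta 0%N)%:P, gamma 0%N = 1,
      forall n, gamma n.+1 != 0 &
      forall n, P n.+2 = ('X - (beta n.+1)%:P) * P n.+1 - gamma n.+1 *: P n].

(* (p(x) - p(xi)) / (x - xi), as a polynomial in x (outer variable) whose
   coefficients are polynomials in xi (inner variable). The divisor is monic
   in x and divides the numerator, so the division is exact. *)
Definition divided_diff (p : {poly K}) : {poly {poly K}} :=
  (p^:P - p%:P) %/ ('X - ('X)%:P).

(* The coefficientwise action of [u] is the action on the variable xi. *)
Definition assoc1 u P (n : nat) : {poly K} := map_poly u (divided_diff (P n.+1)).

(* [assoc1_pred u P n] is the associated polynomial of index n - 1. *)
Definition assoc1_pred u P (n : nat) : {poly K} :=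
  if n is m.+1 then assoc1 u P m else 0.

End Forms.

(** * Formal Laurent series in 1/z, and the Laguerre-Hahn equation *)

Section Laurent.
Variable K : fieldType.

(* [f k] is the coefficient of z^k, for k : int; the series used below all have
   support bounded above. *)
Definition laurent := int -> K.

Definition laurent_of_poly (p : {poly K}) : laurent :=
  fun k => if k is Posz n then p`_n else 0.

Definition laurent_add (f g : laurent) : laurent := fun k => f k + g k.

(* For f and g with support bounded above, only finitely many terms of this sum
   are nonzero, so it is the Cauchy product. *)
Definition laurent_mul (f g : laurent) : laurent :=
  fun k => \sum_(i \in [set: int]) (f i * g (k - i)).

Definition laurent_deriv (f : laurent) : laurent :=
  fun k => (k + 1)%:~R * f (k + 1).

(* [Negz n] is the integer - n - 1. *)
Definition stieltjes (u : {scalar {poly K}}) : laurent :=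
  fun k => if k is Negz n then - moment u n else 0.

Definition laguerre_hahn (u : {scalar {poly K}}) (Phi B C D : {poly K}) : Prop :=
  let S := stieltjes u in
  Phi \is monic /\
  laurent_mul (laurent_of_poly Phi) (laurent_deriv S) =1
  laurent_add
    (laurent_add (laurent_mul (laurent_of_poly B) (laurent_mul S S))
                 (laurent_mul (laurent_of_poly C) S))
    (laurent_of_poly D).

End Laurent.

(** * The polynomials C_n, D_n and the coefficients G, H, M, F *)

Section Coefficients.
Variable K : fieldType.
Variables (Phi B C D : {poly K}) (beta gamma : nat -> K).

(* [lh_seq n] is (D_{n-1}, C_n, D_n), with D_{-1} = B. *)
Fixpoint lh_seq (n : nat) : {poly K} * {poly K} * {poly K} :=
  if n is m.+1 then
    let: (Dp, Cm, Dm) := lh_seq m in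
    let x := 'X - (beta m)%:P in
    (Dm,
     - Cm + 2 *: (x * Dm),
     (gamma m.+1)^-1 *: (- Phi + gamma m *: Dp - x * Cm + x ^+ 2 * Dm))
  else (B, C, D).

Definition Cn (n : nat) : {poly K} := (lh_seq n).1.2.
Definition Dn (n : nat) : {poly K} := (lh_seq n).2.

Local Notation "½" := (2^-1 : K).
Local Notation B0 := B.
Local Notation C0 := (Cn 0).
Local Notation D0 := (Dn 0).

Definition G01 (n : nat) : {poly K} := 0.
Definition G11 (n : nat) : {poly K} := B0.
Definition H1 n := - (gamma n.+1 *: Dn n.+1).

Definition G02 n := - ((2 * gamma n.+1) *: (B0 * Dn n.+1)).
Definition G12 n := ½ *: (Cn n.+1 + C0) * B0 + Phi * B0^`().
Definition H2 n :=
  gamma n.+1 *: (½ *: (Cn n.+1 + C0) * Dn n.+1 - Phi * (Dn n.+1)^`()).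

Definition G03 n :=
  gamma n.+1 *: (Dn n.+1 * (Cn n.+1 - C0) * B0
                 - 3 *: (Phi * (B0 * Dn n.+1)^`())).
Definition G13 n :=
  B0 * (4^-1 *: (Cn n.+1 + C0) ^+ 2 - (2 * gamma n.+1) *: (Dn n * Dn n.+1)
        + ½ *: (Phi * (Cn n.+1 + C0)^`()))
  + Phi * B0^`() * (Cn n.+1 + C0 + Phi^`())
  + Phi ^+ 2 * B0^`(2).
Definition H3 n :=
  gamma n.+1 *: ((2 *: (B0 * D0) + ½ *: ((Cn n.+1 + C0)^`() * Phi)
                  - 4^-1 *: (Cn n.+1 + C0) ^+ 2) * Dn n.+1)
  + gamma n.+1 *: (Phi * (Cn n.+1 + C0 - Phi^`()) * (Dn n.+1)^`())
  - gamma n.+1 *: (Phi ^+ 2 * (Dn n.+1)^`(2)).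

Definition G04 n :=
  - (½ *: (Cn n.+1 - C0) * G03 n) - gamma n.+1 *: (Dn n.+1 * G13 n)
  + B0 * H3 n + Phi * (G03 n)^`().
Definition G14 n :=
  Dn n * G03 n + ½ *: (Cn n.+1 + C0) * G13 n + Phi * (G13 n)^`().
Definition H4 n :=
  - (D0 * G03 n) - ½ *: (Cn n.+1 + C0) * H3 n + Phi * (H3 n)^`().

Definition M01 n := - (½ *: (Cn n.+1 - C0)).

Definition M12 n := Phi * (Phi^`() + M01 n).
Definition M02 n :=
  Phi * (M01 n)^`() + B0 * D0 + gamma n.+1 *: (Dn n * Dn n.+1).

Definition M23 n := Phi * (M12 n + 2 *: (Phi * Phi^`())).
Definition M13 n := Phi * (M02 n + (M12 n)^`()).
Definition M03 n := Phi * (M02 n)^`() + D0 * G12 n - Dn n * H2 n.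

Definition M34 n := Phi * (M23 n + 3 *: (Phi ^+ 2 * Phi^`())).
Definition M24 n := Phi * ((M23 n)^`() + M13 n).
Definition M14 n := Phi * ((M13 n)^`() + M03 n).
Definition M04 n := Phi * (M03 n)^`() + D0 * G13 n - Dn n * H3 n.

Variable P : nat -> {poly K}.

Definition F1 n := Phi * (P n.+1)^`() + M01 n * P n.+1.
Definition F2 n :=
  Phi ^+ 2 * (P n.+1)^`(2) + M12 n * (P n.+1)^`() + M02 n * P n.+1.
Definition F3 n :=
  Phi ^+ 3 * (P n.+1)^`(3) + M23 n * (P n.+1)^`(2) + M13 n * (P n.+1)^`()
  + M03 n * P n.+1.
Definition F4 n :=
  Phi ^+ 4 * (P n.+1)^`(4) + M34 n * (P n.+1)^`(3) + M24 n * (P n.+1)^`(2)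
  + M14 n * (P n.+1)^`() + M04 n * P n.+1.

(* G_{0,k}, G_{1,k}, H_k and F_k for k in {1, 2, 3, 4}; the value 0 for other
   k is irrelevant. *)
Definition G0 (k n : nat) : {poly K} :=
  match k with 1 => G01 n | 2 => G02 n | 3 => G03 n | 4 => G04 n | _ => 0 end.
Definition G1 (k n : nat) : {poly K} :=
  match k with 1 => G11 n | 2 => G12 n | 3 => G13 n | 4 => G14 n | _ => 0 end.
Definition H (k n : nat) : {poly K} :=
  match k with 1 => H1 n | 2 => H2 n | 3 => H3 n | 4 => H4 n | _ => 0 end.
Definition F (k n : nat) : {poly K} :=
  match k with 1 => F1 n | 2 => F2 n | 3 => F3 n | 4 => F4 n | _ => 0 end.

End Coefficients.

(* Main.v *)
(** Put s = (C_{n+1} + C_0)/2, d = (C_{n+1} - C_0)/2 and Q_n = P_{n-1}^{(1)}.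
    By orthogonality Q satisfies the same three-term recurrence as P, and
    induction on n then shows that P_{n+1}, P_n, Q_{n+1}, Q_n solve a first
    order linear differential system with leading coefficient Phi whose
    coefficients are s, d, B_0, D_0, D_n and gamma_{n+1} D_{n+1}. Its equation
    for P_{n+1} is the case k = 1; applying Phi d/dx to the case k and
    eliminating Q_n', Q_{n+1}', P_n' by the system gives the case k + 1. *)

Require Import Defs.
From mathcomp Require Import all_boot all_order all_algebra.
From mathcomp Require Import reals complex.
From mathcomp Require Import ring.
Import GRing.Theory.
Local Open Scope ring_scope.

(** * Divided differences in the variables x and xi *)

Section DividedDifference.
Variable K : fieldType.
Implicit Types (p : {poly K}) (u : {scalar {poly K}}).

Lemma divided_diffK p :
  divided_diff p * ('X - ('X)%:P) = p^:P - p%:P.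
Proof.
apply: Pdiv.IdomainUnit.divpK; first by rewrite lead_coefXsubC unitr1.
rewrite dvdp_XsubCl /root !hornerE.
(* The numerator vanishes at x = xi: its first term there is p composed with the identity. *)
by rewrite -[(p^:P).['X]]/(p \Po 'X) comp_polyXr subrr.
Qed.

(** Cancelling x - xi reduces identities between divided differences to identities between
    numerators, by [divided_diffK]. *)
Lemma mul_XsubX_inj : injective ( *%R^~ ('X - ('X)%:P : {poly {poly K}})).
Proof. by apply: mulIf; rewrite polyXsubC_eq0. Qed.

(** Leibniz rule: (x-b)p(x) - (xi-b)p(xi) = (x-b)(p(x)-p(xi)) + (x-xi)p(xi), where p(xi) is
    [p%:P]. *)
Lemma divided_diff_mulXsubC b p :
  divided_diff (('X - b%:P) * p)
  = ('X - b%:P%:P) * divided_diff p + p%:P.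
Proof.
apply: mul_XsubX_inj => /=.
rewrite divided_diffK [RHS]mulrDl -[X in _ = X + _]mulrA divided_diffK.
rewrite rmorphM /= rmorphB /= map_polyX map_polyC /= polyCM polyCB.
by ring.
Qed.

Lemma divided_diff_lin a p q :
  divided_diff (p - a *: q) = divided_diff p - a%:P%:P * divided_diff q.
Proof.
apply: mul_XsubX_inj => /=.
rewrite [RHS]mulrBl -[X in _ = _ - X]mulrA !divided_diffK -mul_polyC.
rewrite !(rmorphB, rmorphM) /= map_polyC /=.
by ring.
Qed.

Lemma divided_diff1 : divided_diff (1 : {poly K}) = 0.
Proof.
apply: mul_XsubX_inj => /=.
by rewrite divided_diffK mul0r rmorph1 subrr.
Qed.

Lemma map_scalar_mulC u b (q : {poly {poly K}}) :
  map_poly u (b%:P%:P * q) = b%:P * map_poly u q.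
Proof.
by apply/polyP=> i; rewrite !(coef_map, coefCM) /= mul_polyC linearZ.
Qed.

Lemma map_scalar_mulX u (q : {poly {poly K}}) :
  map_poly u ('X * q) = 'X * map_poly u q.
Proof.
apply/polyP=> i; rewrite !(coef_map, coefXM) /=.
by case: eqP => _; rewrite ?raddf0 ?coef_map.
Qed.

End DividedDifference.

(** * Three-term recurrence of the associated polynomials *)

Section AssociatedRecurrence.
Variables (K : fieldType) (u : {scalar {poly K}}) (P : nat -> {poly K}).
Variables (beta gamma : nat -> K).
Hypotheses (hu : normalized u) (hP : is_mops u P).
Hypothesis hrec : recurrence_coeffs P beta gamma.

Lemma mops_scalar_eq0 n : u (P n.+1) = 0.
Proof.
have [P0 _ _ _ _] := hrec; have [_ [r [_ /(_ n.+1 0%N)]]] := hP.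
by rewrite P0 mulr1.
Qed.

Lemma assoc1_0 : assoc1 u P 0 = 1.
Proof.
have [P0 P1 _ _ _] := hrec.
rewrite /assoc1 P1 -['X - _]mulr1 divided_diff_mulXsubC divided_diff1.
rewrite mulr0 add0r map_polyC /=.
by move: hu; rewrite /normalized /moment expr0 => ->.
Qed.

Lemma assoc1_pred_rec n :
  assoc1_pred u P n.+2
  = ('X - (beta n.+1)%:P) * assoc1_pred u P n.+1
    - gamma n.+1 *: assoc1_pred u P n.
Proof.
have [P0 _ _ _ PS] := hrec.
(* The value 0 at index 0 fits this formula too, since the constant [P 0] has divided difference
   0. *)
have -> : assoc1_pred u P n = map_poly u (divided_diff (P n)).
  by case: n => //=; rewrite P0 divided_diff1 raddf0.
rewrite /= /assoc1 PS divided_diff_lin divided_diff_mulXsubC mulrBl.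
rewrite !(raddfB, raddfD) /= !map_scalar_mulC map_scalar_mulX map_polyC /=.
(* The extra Leibniz term becomes [u (P n.+1)], which orthogonality to [P 0 = 1] kills. *)
by rewrite mops_scalar_eq0 polyC0 addr0 mulrBl mul_polyC mul_polyC.
Qed.

End AssociatedRecurrence.

(** * The first order differential system *)

Section StructureRelations.
Variables (K : fieldType) (Phi B C D : {poly K}) (beta gamma : nat -> K).
Variables P Q : nat -> {poly K}.
Hypothesis two_neq0 : 2 != 0 :> K.
Hypothesis gamma_neq0 : forall n, gamma n.+1 != 0.
Hypothesis gamma0 : gamma 0%N = 1.
Hypotheses (P0 : P 0%N = 1) (P1 : P 1%N = 'X - (beta 0%N)%:P).
Hypotheses (Q0 : Q 0%N = 0) (Q1 : Q 1%N = 1).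
Hypothesis PS :
  forall n, P n.+2 = ('X - (beta n.+1)%:P) * P n.+1 - gamma n.+1 *: P n.
Hypothesis QS :
  forall n, Q n.+2 = ('X - (beta n.+1)%:P) * Q n.+1 - gamma n.+1 *: Q n.

Local Notation Cn := (Cn Phi B C D beta gamma).
Local Notation Dn := (Dn Phi B C D beta gamma).

Definition half_sum n := 2^-1 *: (Cn n.+1 + Cn 0).
Definition half_diff n := 2^-1 *: (Cn n.+1 - Cn 0).

Lemma CnS n : Cn n.+1 = - Cn n + 2 *: (('X - (beta n)%:P) * Dn n).
Proof. by rewrite /Defs.Cn /Defs.Dn /=; case: lh_seq => [[]]. Qed.

Lemma DnS0 :
  gamma 1%N *: Dn 1
  = - Phi + B - ('X - (beta 0%N)%:P) * Cn 0 + ('X - (beta 0%N)%:P) ^+ 2 * Dn 0.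
Proof. by rewrite /Defs.Cn /Defs.Dn /= scalerA divff // scale1r gamma0 scale1r. Qed.

Lemma DnSS n :
  gamma n.+2 *: Dn n.+2
  = - Phi + gamma n.+1 *: Dn n - ('X - (beta n.+1)%:P) * Cn n.+1
    + ('X - (beta n.+1)%:P) ^+ 2 * Dn n.+1.
Proof.
rewrite /Defs.Cn /Defs.Dn /=; case: lh_seq => [[Dp Cm] Dm] /=.
by rewrite scalerA divff // scale1r.
Qed.

Lemma halfK (p : {poly K}) : 2^-1 *: (2 *: p) = p.
Proof. by rewrite scalerA mulVf // scale1r. Qed.

Lemma CnS_half n : Cn n.+1 = half_sum n + half_diff n.
Proof.
by rewrite /half_sum /half_diff -scalerDr addrACA subrr addr0 -mulr2n
  -scaler_nat halfK.
Qed.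

Lemma half_sum0 : half_sum 0 = ('X - (beta 0%N)%:P) * Dn 0.
Proof. by rewrite /half_sum CnS addrAC addNr add0r halfK. Qed.

Lemma half_diff0 : half_diff 0 = ('X - (beta 0%N)%:P) * Dn 0 - Cn 0.
Proof.
by rewrite -half_sum0 -[X in _ - X]halfK scaler_nat mulr2n /half_diff
  /half_sum -scalerBr addrKA.
Qed.

(** The sign change of C in its recursion exchanges the roles of s and d at each step. *)
Lemma half_sumS n :
  half_sum n.+1 = ('X - (beta n.+1)%:P) * Dn n.+1 - half_diff n.
Proof.
rewrite /half_sum CnS -[X in _ = X - _]halfK /half_diff -scalerBr.
by congr (_ *: _); ring.
Qed.

Lemma half_diffS n :
  half_diff n.+1 = ('X - (beta n.+1)%:P) * Dn n.+1 - half_sum n.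
Proof.
rewrite /half_diff CnS -[X in _ = X - _]halfK /half_sum -scalerBr.
by congr (_ *: _); ring.
Qed.

(** In the induction step, the second and fourth equations at n+1 are the first and third at n,
    rewritten by the recurrences; the other two come from differentiating the recurrences for
    [P n.+2] and [Q n.+2]. *)
Lemma structure_relations n :
  [/\ Phi * (P n.+1)^`()
      = half_diff n * P n.+1 - gamma n.+1 *: Dn n.+1 * P n + B * Q n.+1,
      Phi * (P n)^`() = - half_sum n * P n + Dn n * P n.+1 + B * Q n,
      Phi * (Q n.+1)^`()
      = half_sum n * Q n.+1 - gamma n.+1 *: Dn n.+1 * Q n - Dn 0 * P n.+1 &
      Phi * (Q n)^`() = - half_diff n * Q n + Dn n * Q n.+1 - Dn 0 * P n].
Proof.
elim: n => [|n [EP' EP EQ' EQ]].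
  rewrite P0 P1 Q0 Q1 half_sum0 half_diff0 DnS0 derivXsubC derivC.
  by rewrite -[1]/(1%:P) !derivC polyC1; split; ring.
rewrite DnSS CnS_half half_sumS half_diffS PS QS -!mul_polyC in EP' EQ' *.
have derivS (p q : {poly K}) b c :
    Phi * (('X - b%:P) * p - c%:P * q)^`()
    = Phi * p + ('X - b%:P) * (Phi * p^`()) - c%:P * (Phi * q^`()).
  by rewrite derivB !derivM derivXsubC derivC; ring.
rewrite !derivS EP EQ EP' EQ'; split; ring.
Qed.

(** The [P n.+1] terms produced by the derivatives of [Q n.+1] and [P n] move to the right, which
    explains the last two terms of [M03] and [M04]. *)
Lemma raise_relation n (G0 G1 H F : {poly K}) :
  G0 * Q n + G1 * Q n.+1 + H * P n = F ->
  (Phi * G0^`() - half_diff n * G0 - gamma n.+1 *: Dn n.+1 * G1 + B * H) * Q n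
  + (Dn n * G0 + half_sum n * G1 + Phi * G1^`()) * Q n.+1
  + (- (Dn 0 * G0) - half_sum n * H + Phi * H^`()) * P n
  = Phi * F^`() + (Dn 0 * G1 - Dn n * H) * P n.+1.
Proof.
have [_ EP EQ' EQ] := structure_relations n.
move=> <-; rewrite !derivD !derivM.
rewrite [Phi * (_ + _)](_ : _ = Phi * G0^`() * Q n + G0 * (Phi * (Q n)^`())
  + (Phi * G1^`() * Q n.+1 + G1 * (Phi * (Q n.+1)^`()))
  + (Phi * H^`() * P n + H * (Phi * (P n)^`()))); last by ring.
by rewrite EP EQ EQ' -!mul_polyC; ring.
Qed.

Lemma sum_half n : Cn n.+1 + Cn 0 = half_sum n *+ 2.
Proof. by rewrite -scaler_nat /half_sum scalerA divff // scale1r. Qed.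

Lemma diff_half n : Cn n.+1 - Cn 0 = half_diff n *+ 2.
Proof. by rewrite -scaler_nat /half_diff scalerA divff // scale1r. Qed.

Lemma half_mulr2n (p : {poly K}) : 2^-1 *: (p *+ 2) = p.
Proof. by rewrite -scaler_nat halfK. Qed.

Lemma quarter_mulr4n (p : {poly K}) : 4^-1 *: (p *+ (2 ^ 2)) = p.
Proof.
by rewrite -scaler_nat scalerA mulVf ?scale1r // (natrM _ 2 2) mulf_neq0.
Qed.

(** Compares a raised relation with the stated closed forms by a single ring identity covering all
    coefficients. *)
Lemma subr_transfer (p q p' q' : {poly K}) :
  p = q -> p' - q' = p - q -> p' = q'.
Proof. by move=> -> /eqP; rewrite subrr subr_eq0 => /eqP. Qed.

(** Cancels the scalars 1/2 and 1/4 against 2s, 2d and (2s)^2, leaving integer coefficients. *)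
Definition halfE := (sum_half, diff_half, derivMn, mulrnAr, mulrnAl, exprMn_n,
  half_mulr2n, quarter_mulr4n).

(** * The relations for k = 1 to 4 *)

Local Notation rel G0 G1 H F :=
  (forall n, G0 n * Q n + G1 n * Q n.+1 + H n * P n = F n).

Lemma relation1 :
  rel (@G01 K) (fun n => G11 B n) (H1 Phi B C D beta gamma)
      (F1 Phi B C D beta gamma P).
Proof.
move=> n; rewrite /G01 /G11 /H1 /F1 /M01 !halfE.
have [-> _ _ _] := structure_relations n.
by ring.
Qed.

Lemma relation2 :
  rel (G02 Phi B C D beta gamma) (G12 Phi B C D beta gamma)
      (H2 Phi B C D beta gamma) (F2 Phi B C D beta gamma P).
Proof.
move=> n; apply: subr_transfer (raise_relation _ _ _ _ _ (relation1 n)) _.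
rewrite /G02 /G12 /H2 /F2 /M12 /M02 /G01 /G11 /H1 /F1 /M01 -?scalerA ?scaler_nat !halfE.
(* From here s and d are indeterminates, so the derivative rules do not expand them. *)
move: (half_sum n) (half_diff n) => s d; rewrite /derivn /= !(derivD, derivM, derivN, derivZ, derivC).
by rewrite -!mul_polyC; ring.
Qed.

Lemma relation3 :
  rel (G03 Phi B C D beta gamma) (G13 Phi B C D beta gamma)
      (H3 Phi B C D beta gamma) (F3 Phi B C D beta gamma P).
Proof.
move=> n; apply: subr_transfer (raise_relation _ _ _ _ _ (relation2 n)) _.
rewrite /G03 /G13 /H3 /F3 /M23 /M13 /M03 /G02 /G12 /H2 /F2 -?scalerA ?scaler_nat !halfE.
move: (half_sum n) (half_diff n) => s d; rewrite /derivn /= !(derivD, derivM, derivN, derivB, derivZ) !expr2.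
by rewrite -!mul_polyC; ring.
Qed.

Lemma relation4 :
  rel (G04 Phi B C D beta gamma) (G14 Phi B C D beta gamma)
      (H4 Phi B C D beta gamma) (F4 Phi B C D beta gamma P).
Proof.
move=> n; apply: subr_transfer (raise_relation _ _ _ _ _ (relation3 n)) _.
rewrite /G04 /G14 /H4 /F4 /M34 /M24 /M14 /M04 !halfE /F3.
move: (half_sum n) (half_diff n) => s d; rewrite /derivn /= !(derivD, derivM, exprS, expr0, mulr1).
by rewrite -!mul_polyC; ring.
Qed.

End StructureRelations.

Theorem theorem4 (R : realType) (u : {scalar {poly R[i]}})
    (P : nat -> {poly R[i]}) (beta gamma : nat -> R[i])
    (Phi B C D : {poly R[i]})
    (hu : normalized u)
    (hP : is_mops u P)
    (hrec : recurrence_coeffs P beta gamma)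
    (hLH : laguerre_hahn u Phi B C D)
    (n k : nat) (hk : (1 <= k <= 4)%N) :
  G0 Phi B C D beta gamma k n * assoc1_pred u P n
  + G1 Phi B C D beta gamma k n * assoc1 u P n
  + H Phi B C D beta gamma k n * P n
  = F Phi B C D beta gamma P k n.
Proof.
have [P0 P1 g0 gN0 PS] := hrec.
have two_neq0 : 2 != 0 :> R[i] by rewrite Num.Theory.pnatr_eq0.
have QS := assoc1_pred_rec _ _ _ _ _ hP hrec.
have Q1 : assoc1_pred u P 1 = 1 by apply: assoc1_0 hu hrec.
case: k hk => [|[|[|[|[|k]]]]] // _.
(* With this choice of Q, [Q n.+1] reduces to [assoc1 u P n] and [Q 0] to 0. *)
- exact: (relation1 _ _ _ _ _ _ _ _ (assoc1_pred u P)).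
- exact: (relation2 _ _ _ _ _ _ _ _ (assoc1_pred u P)).
- exact: (relation3 _ _ _ _ _ _ _ _ (assoc1_pred u P)).
- exact: (relation4 _ _ _ _ _ _ _ _ (assoc1_pred u P)).
Qed.
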